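(* Let $A\subset\omega^\omega$. Then: (i) Player I has a winning strategy in the game $G^{**}(A)$ if and only if there is a nonempty open set $G\subset\omega^\omega$ such that $A$ is comeager in $G$. (ii) Player II has a winning strategy in the game $G^{**}(A)$ if and only if $A$ is meager.
   Context: $\omega^\omega$ is the Baire space, with basic open sets $O_s=\{f\in\omega^\omega : s \text{ is an initial segment of } f\}$ for $s$ a finite sequence of natural numbers. Meager means a countable union of nowhere dense sets. For an open set $G$, $A$ is comeager in $G$ if $G\setminus A$ is meager. The game $G^{**}(A)$: Players I and II alternately play nonempty finite sequences of natural numbers, I playing $u_0$, II playing $u_1$, I playing $u_2$, II playing $u_3$, and so on (perfect information, infinitely many moves). Let $f=u_0\cdot u_1\cdot u_2\cdots\in\omega^\omega$ be the concatenation (the dot denotes concatenation of sequences). Player I wins if $f\in A$; otherwise Player II wins. Strategies and winning strategies are understood in the usual sense. *)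

(* Defs.v *)
(* MathComp-Analysis *)
From mathcomp Require Import all_boot all_order.
From mathcomp Require Import all_classical.
From mathcomp Require Import topology function_spaces.

Set Implicit Arguments.
Unset Strict Implicit.
Unset Printing Implicit Defensive.

Local Open Scope classical_set_scope.

(* The product of countably many copies of the discrete space nat;
   [open_baireP] below identifies it with the topology based on the sets O_s. *)
Definition baire : topologicalType := prod_topology (fun _ : nat => nat).

Definition cylinder (s : seq nat) : set baire :=
  [set f | mkseq f (size s) = s].

Lemma open_cylinder (s : seq nat) : open (cylinder s).
Proof.
elim/last_ind: s => [|s x IHs].
  have -> : cylinder [::] = setT by apply/seteqP.
  exact: openT.
have -> : cylinder (rcons s x) =
    cylinder s `&` (@proj _ (fun _ : nat => nat) (size s)) @^-1` [set x].
  apply/seteqP; split=> f; rewrite /cylinder /= size_rcons mkseqS /proj.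
    by move/rcons_inj=> [].
  by move=> [-> ->].
apply: openI => //; apply: open_comp; last exact: discrete_open.
by move=> f _; exact: proj_continuous.
Qed.

Lemma open_baireP (G : set baire) :
  open G <-> forall f, G f -> exists s, cylinder s f /\ cylinder s `<=` G.
Proof.
split=> [oG f Gf|h]; last first.
  rewrite openE => f Gf; have [s [sf sG]] := h f Gf.
  by apply: filterS sG _; apply: open_nbhs_nbhs; split=> //; exact: open_cylinder.
pose B n := cylinder (mkseq f n).
have BE n g : B n g = (mkseq g n = mkseq f n).
  by rewrite /B /cylinder /mkset size_mkseq.
have BS m n : (m <= n)%N -> B n `<=` B m.
  move=> lemn g; rewrite !BE => /(congr1 (take m)).
  by rewrite -!map_take take_iota (minn_idPl lemn).
have FF : Filter (filter_from [set: nat] B).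
  apply: filter_from_filter; first by exists 0.
  move=> i j _ _; exists (maxn i j) => // g Bg.
  by split; apply: BS Bg; rewrite ?leq_maxl ?leq_maxr.
have cv : filter_from [set: nat] B --> f.
  apply/cvg_sup => i; apply/cvg_image.
    by apply/seteqP; split=> // x _; exists (fun=> x).
  move=> U /nbhs_singleton Ufi.
  exists ((@proj _ (fun _ : nat => nat) i) @^-1` U).
    exists i.+1 => // g; rewrite BE !mkseqS.
    by move=> /rcons_inj /(congr1 snd) /= e; rewrite /proj /= e.
  by apply/seteqP; split=> [_ [g Ug <-]|x Ux] //; exists (fun=> x).
have [n _ BG] : filter_from [set: nat] B G by apply: cv; exact: open_nbhs_nbhs.
by exists (mkseq f n); split=> //; rewrite -/(B n) BE.
Qed.

Definition nowhere_dense (T : topologicalType) (A : set T) : Prop :=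
  interior (closure A) = set0.

Definition meager (T : topologicalType) (A : set T) : Prop :=
  exists F : nat -> set T,
    (forall n, nowhere_dense (F n)) /\ A = \bigcup_n F n.

Definition comeager_in (T : topologicalType) (A G : set T) : Prop :=
  meager (G `\` A).

Definition move : Type := {s : seq nat | s != [::]}.

(* [u n] is the n-th move, made by Player I if n is even and by Player II if
   n is odd. *)
Definition play : Type := nat -> move.

(* The first n.+1 moves are nonempty, so together they have length at least
   n.+1 and already determine entry n of the infinite concatenation. *)
Definition concat (u : play) : baire :=
  fun n => nth 0 (flatten (mkseq (fun i => val (u i)) n.+1)) n.

Lemma concat_cylinder (u : play) (n : nat) :
  cylinder (flatten (mkseq (fun i => val (u i)) n)) (concat u).
Proof.
pose c m := flatten (mkseq (fun i => val (u i)) m).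
have cS m : c m.+1 = c m ++ val (u m).
  by rewrite /c mkseqS flatten_rcons.
have cD m k : exists t, c (m + k)%N = c m ++ t.
  elim: k => [|k [t IHk]]; first by exists [::]; rewrite addn0 cats0.
  by exists (t ++ val (u (m + k)%N)); rewrite addnS cS IHk catA.
have sc m : (m <= size (c m))%N.
  elim: m => // m IHm; rewrite cS size_cat -addn1 leq_add //.
  by rewrite lt0n size_eq0; exact: (valP (u m)).
rewrite /cylinder /= -/(c n); apply: (@eq_from_nth _ 0); rewrite size_mkseq //.
move=> i lti; rewrite nth_mkseq // /concat -/(c i.+1).
have [le|/ltnW le] := leqP i.+1 n.
  have [t] := cD i.+1 (n - i.+1)%N; rewrite subnKC // => ->.
  by rewrite nth_cat sc.
have [t] := cD n (i.+1 - n)%N; rewrite subnKC // => ->.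
by rewrite nth_cat lti.
Qed.

(* A strategy maps each position, the list of all moves made so far, to the
   next move; its values at the opponent's positions are never used. *)
Definition strategy : Type := seq move -> move.

Definition follows_I (sigma : strategy) (u : play) : Prop :=
  forall n, ~~ odd n -> u n = sigma (mkseq u n).

Definition follows_II (tau : strategy) (u : play) : Prop :=
  forall n, odd n -> u n = tau (mkseq u n).

Definition winning_I (A : set baire) (sigma : strategy) : Prop :=
  forall u : play, follows_I sigma u -> A (concat u).

Definition winning_II (A : set baire) (tau : strategy) : Prop :=
  forall u : play, follows_II tau u -> ~ A (concat u).

(* Main.v *)
Require Import Defs.
From mathcomp Require Import all_boot all_order.
From mathcomp Require Import all_classical.
From mathcomp Require Import topology function_spaces.

(** Nowhere density is itself one round of the game.  By [nowhere_denseP], a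
    set [N] is nowhere dense exactly when every finite sequence [s] can be
    prolonged by a nonempty [t] so that no element of [N] begins with [s ++ t]:
    whatever has been played, the next player can leave [N] for good in a
    single move.

    From category to strategies: if [F 0, F 1, ...] are nowhere dense, the
    strategy that leaves [F n] with the [n]-th move ([avoiding_strategy])
    avoids [F n] for every [n] at which it is followed.  A player
    owns infinitely many moves, hence can serve a whole countable family, one
    set per turn.  For Player II this avoids a meager set; Player I first
    enters a basic open subset of [G] and then avoids [G `\` A].

    From strategies to category: fix a strategy [e] of one of the players.  For
    a position [q] where the opponent is to move, let [trap e q] be the set of
    the [f] that begin with [q] but that no opponent's move followed by the
    answer of [e] keeps as a possible outcome.  The answer of [e] is always a
    further prolongation, so each trap is nowhere dense
    ([trap_nowhere_dense]), and there are only countably many positions.  An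
    [f] outside all traps can be followed forever by the opponent, so it is the
    outcome of a play in which [e] is obeyed ([outcome_outside_traps]).  Hence,
    if Player II wins with [e], the traps cover [A]; if Player I wins with [e],
    they cover the part outside [A] of the cylinder of the first move of [e],
    and this cylinder serves as [G]. *)

Local Open Scope classical_set_scope.

(** * Cylinders and nowhere dense sets *)

Lemma cylinder_cat (s t : seq nat) : cylinder (s ++ t) `<=` cylinder s.
Proof.
move=> f; rewrite /cylinder /= size_cat => /(congr1 (take (size s))).
by rewrite take_size_cat // -map_take take_iota (minn_idPl (leq_addr _ _)).
Qed.

Lemma cylinder_mkseqE (f g : baire) (m : nat) :
  cylinder (mkseq f m) g = (mkseq g m = mkseq f m).
Proof. by rewrite /cylinder /= size_mkseq. Qed.

Lemma cylinder_nth (s : seq nat) : cylinder s (nth 0 s).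
Proof. by rewrite /cylinder /= mkseq_nth. Qed.

Lemma cylinder_prolong (f : baire) (s : seq nat) (m : nat) :
  cylinder s f -> (size s <= m)%N -> exists t, mkseq f m = s ++ t.
Proof.
move=> sf lesm; exists (drop (size s) (mkseq f m)).
rewrite -[LHS](cat_take_drop (size s)) -map_take take_iota (minn_idPl lesm).
by congr (_ ++ _).
Qed.

Lemma cylinder_move (f : baire) (s : seq nat) (m : nat) :
  cylinder s f -> (size s < m)%N -> exists t : move, mkseq f m = s ++ val t.
Proof.
move=> sf ltsm; have [t e] := cylinder_prolong f s m sf (ltnW ltsm).
have t0 : t != [::].
  apply: contraTneq ltsm => t0; rewrite -leqNgt.
  by rewrite -[leqLHS](size_mkseq f) e t0 cats0.
by exists (exist _ t t0).
Qed.

(** The complement of the closure of [N] is open, so it contains a cylinder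
    around each of its points; this cylinder may be shrunk at will, whence the
    prolongation can be taken nonempty. *)
Lemma nowhere_denseP (N : set baire) :
  nowhere_dense N <->
  forall s, exists t : move, cylinder (s ++ val t) `&` N = set0.
Proof.
split=> [ndN s|avoid].
  have [f [sf Nf]] : exists f, cylinder s f /\ ~ closure N f.
    apply: contrapT => h; have : interior (closure N) (nth 0 s).
      apply: filterS (open_nbhs_nbhs (conj (open_cylinder s) (cylinder_nth s))).
      by move=> f sf; apply: contrapT => Nf; apply: h; exists f.
    by rewrite ndN.
  have oC : open (~` closure N) by apply: closed_openC; exact: closed_closure.
  have [s' [s'f s'N]] := (open_baireP _).1 oC f Nf.
  pose m := (maxn (size s) (size s')).+1.
  have [t et] := cylinder_move f s m sf (leq_maxl _ _).
  have [t' et'] := cylinder_prolong f s' m s'f (leqW (leq_maxr _ _)).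
  exists t; apply/seteqP; split=> // g [].
  rewrite -et et' => /cylinder_cat /s'N Ng gN.
  by apply: Ng; exact: subset_closure.
apply/seteqP; split=> // f Nf.
have [s [sf sN]] := (open_baireP _).1 (open_interior (closure N)) f Nf.
have [t st0] := avoid s.
pose g : baire := nth 0 (s ++ val t).
have cg : closure N g.
  by apply: interior_subset; apply: sN; apply: cylinder_cat (cylinder_nth _).
have [h [Nh sth]] := cg _ (open_nbhs_nbhs
  (conj (open_cylinder (s ++ val t)) (cylinder_nth _))).
suff : set0 h by [].
by rewrite -st0.
Qed.

Lemma nowhere_dense_subset (T : topologicalType) (A B : set T) :
  A `<=` B -> nowhere_dense B -> nowhere_dense A.
Proof.
move=> AB ndB; apply/seteqP; split=> // x.
by move/(interiorS (closureS AB)); rewrite ndB.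
Qed.

Lemma meager_countable_cover (T : topologicalType) (I : countType)
    (F : I -> set T) (A : set T) :
  (forall i, nowhere_dense (F i)) -> A `<=` \bigcup_i F i -> meager A.
Proof.
move=> ndF AF.
exists (fun n => if unpickle n is Some i then A `&` F i else set0); split.
  move=> n; case: (unpickle n) => [i|].
    exact: nowhere_dense_subset (@subIsetr _ _ _) (ndF i).
  by rewrite /nowhere_dense closure0; apply/seteqP; split=> // x /interior_subset.
apply/seteqP; split=> [x Ax|x [n _]].
  by have [i _ Fx] := AF x Ax; exists (pickle i) => //; rewrite pickleK.
by case: (unpickle n) => // i [].
Qed.

(** * Plays and their outcomes *)

Definition joined (q : seq move) : seq nat := flatten (map val q).

Lemma joined_rcons (q : seq move) (t : move) :
  joined (rcons q t) = joined q ++ val t.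
Proof. by rewrite /joined map_rcons flatten_rcons. Qed.

Lemma joined_mkseq (u : play) (n : nat) :
  joined (mkseq u n) = flatten (mkseq (fun i => val (u i)) n).
Proof. by rewrite /joined /mkseq -map_comp. Qed.

Lemma size_joined (q : seq move) : (size q <= size (joined q))%N.
Proof.
elim/last_ind: q => // q t IHq; rewrite joined_rcons size_cat size_rcons -addn1.
by rewrite leq_add // lt0n size_eq0; exact: (valP t).
Qed.

Lemma concat_joined (u : play) (n : nat) :
  cylinder (joined (mkseq u n)) (concat u).
Proof. by rewrite joined_mkseq; exact: concat_cylinder. Qed.

Lemma concat_unique (u : play) (f : baire) :
  (forall n, cylinder (joined (mkseq u n)) f) -> concat u = f.
Proof.
move=> uf; apply: funext => n; have := uf n.+1.
rewrite /concat -joined_mkseq => {1}<-; rewrite nth_mkseq //.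
by apply: leq_trans (size_joined _); rewrite size_mkseq.
Qed.

Lemma play_of_strategy (s : strategy) :
  exists u : play, forall n, u n = s (mkseq u n).
Proof.
pose q n := iter n (fun p => rcons p (s p)) [::].
exists (s \o q) => n; congr s; elim: n => // n IHn.
by rewrite mkseqS -IHn.
Qed.

(** * Strategies that avoid nowhere dense sets *)

Lemma avoiding_strategy (F : nat -> set baire) :
  (forall n, nowhere_dense (F n)) ->
  exists e : strategy,
    forall u n, u n = e (mkseq u n) -> ~ F n (concat u).
Proof.
move=> ndF.
have /choice[e eP] (q : seq move) : exists t : move,
    cylinder (joined q ++ val t) `&` F (size q) = set0.
  exact: (nowhere_denseP _).1 (ndF _) (joined q).
exists e => u n un Fu.
have := eP (mkseq u n); rewrite size_mkseq -un -joined_rcons -mkseqS => h.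
suff : set0 (concat u) by [].
by rewrite -h; split=> //; exact: concat_joined.
Qed.

(** * Traps of a strategy *)

Definition round (e : strategy) (q : seq move) (t : move) : seq move :=
  rcons (rcons q t) (e (rcons q t)).

Definition trap (e : strategy) (q : seq move) : set baire :=
  cylinder (joined q) `\` \bigcup_t cylinder (joined (round e q t)).

(** Prolong [s] beyond the length of [q].  If the result does not begin with
    [q], it already misses the trap.  If it does, the surplus is a legal
    opponent's move, and appending the answer of [e] to it escapes the trap. *)
Lemma trap_nowhere_dense (e : strategy) (q : seq move) :
  nowhere_dense (trap e q).
Proof.
apply/nowhere_denseP => s; pose f : baire := nth 0 s.
pose m := (maxn (size s) (size (joined q))).+1.
have [t et] := cylinder_move f s m (cylinder_nth s) (leq_maxl _ _).
have [qf|qf] := pselect (cylinder (joined q) f); last first.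
  exists t; rewrite -et; apply/seteqP; split=> // g [gf [gq _]].
  have [t' et'] :=
    cylinder_prolong g (joined q) m gq (leqW (leq_maxr _ _)).
  apply: qf; apply: (cylinder_cat _ t').
  by rewrite -et' cylinder_mkseqE; rewrite cylinder_mkseqE in gf.
have [x ex] := cylinder_move f (joined q) m qf (leq_maxr _ _).
have ne : val t ++ val (e (rcons q x)) != [::].
  by rewrite -size_eq0 size_cat addn_eq0 !size_eq0 (negPf (valP t)).
exists (exist _ (val t ++ val (e (rcons q x))) ne); apply/seteqP; split=> // g [/= gs [_ []]].
by exists x => //; rewrite /round !joined_rcons -ex et -catA.
Qed.

(** The boolean [b] is the parity of the turns of the player who uses [e]:
    [false] for Player I, [true] for Player II.  Player I moves before the
    first round, hence the condition on the opening move. *)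
Lemma outcome_outside_traps (e : strategy) (b : bool) (f : baire) :
  (~~ b -> cylinder (val (e [::])) f) -> (forall q, ~ trap e q f) ->
  exists u : play,
    (forall n, odd n = b -> u n = e (mkseq u n)) /\ concat u = f.
Proof.
move=> open_f out.
(* The value [e q] below is only a default, where [f] has already left [q]. *)
have /choice[o oP] (q : seq move) : exists t : move,
    cylinder (joined q) f -> cylinder (joined (round e q t)) f.
  have [qf|qf] := pselect (cylinder (joined q) f); last by exists (e q).
  apply: contrapT => h; apply: (out q); split=> // -[t _ tf].
  by apply: h; exists t.
have [u uP] := play_of_strategy
  (fun q => if odd (size q) == b then e q else o q).
exists u; have ue n : odd n = b -> u n = e (mkseq u n).
  by move=> nb; rewrite uP size_mkseq nb eqxx.
split=> //; apply: concat_unique.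
(* The choice of [o] controls whole rounds only, so first treat the positions
   at the opponent's turns. *)
have opp k : cylinder (joined (mkseq u (k.*2 + ~~ b))) f.
  elim: k => [|k IHk].
    case: b open_f ue {uP} => // /(_ isT) open_f ue.
    by rewrite /joined /= ue // cats0.
  have uo : u (k.*2 + ~~ b)%N = o (mkseq u (k.*2 + ~~ b)).
    by rewrite uP size_mkseq oddD odd_double /=; case: b {open_f ue uP IHk}.
  rewrite doubleS !addSn mkseqS ue; last first.
    by rewrite /= oddD odd_double /=; case: b {open_f ue uP IHk uo}.
  by rewrite mkseqS uo; exact: oP.
move=> n.
have ltn : (n <= n.*2 + ~~ b)%N by rewrite -addnn -addnA leq_addr.
have : cylinder (joined (mkseq u (n.*2 + ~~ b))) f by exact: opp.
rewrite -[mkseq u _](cat_take_drop n) -map_take take_iota (minn_idPl ltn).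
by rewrite /joined map_cat flatten_cat => /cylinder_cat.
Qed.

(** * The Banach-Mazur theorem *)

Theorem theorem3p6p4 (A : set baire) :
  ((exists sigma : strategy, winning_I A sigma) <->
   (exists G : set baire, [/\ open G, G !=set0 & comeager_in A G])) /\
  ((exists tau : strategy, winning_II A tau) <-> meager A).
Proof.
split; split.
- move=> [sigma win]; pose s := val (sigma [::]).
  exists (cylinder s); split; first exact: open_cylinder.
    by exists (nth 0 s); exact: cylinder_nth.
  (* Unfolding [move] reveals the subtype that makes positions countable. *)
  apply: (meager_countable_cover _ (seq {s : seq nat | s != [::]})
            (trap sigma)) => [q|f [sf nAf]].
    exact: trap_nowhere_dense.
  apply: contrapT => out; apply: nAf.
  have [q qf|u [us <-]] := outcome_outside_traps sigma false f (fun=> sf).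
    by apply: out; exists q.
  by apply: win => n /negPf; exact: us.
- move=> [G [oG [f Gf] [F [ndF GF]]]].
  have [s0 [s0f s0G]] := (open_baireP G).1 oG f Gf.
  (* An empty [s0] would not be a legal move. *)
  have [s es] := cylinder_move f [::] (size s0).+1 erefl isT.
  have sG : cylinder (val s) `<=` G.
    have [t et] := cylinder_prolong f s0 (size s0).+1 s0f (leqnSn _).
    by move: es; rewrite et /= => <-; apply: subset_trans s0G; exact: cylinder_cat.
  have [e eP] := avoiding_strategy (fun n => F n./2.-1) (fun n => ndF _).
  exists (fun q => if q is [::] then s else e q) => u follows.
  have Gu : G (concat u).
    apply: sG; have := concat_joined u 1.
    by rewrite /joined /= follows //= cats0.
  apply: contrapT => nAu.
  have [k _ Fu] : (\bigcup_n F n) (concat u) by rewrite -GF.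
  (* Turn 0 is spent on entering [G], so [F k] is left at turn [k.+1]. *)
  apply: (eP u k.+1.*2); last by rewrite doubleK.
  by rewrite follows ?odd_double.
- move=> [tau win].
  apply: (meager_countable_cover _ (seq {s : seq nat | s != [::]})
            (trap tau)) => [q|f Af].
    exact: trap_nowhere_dense.
  apply: contrapT => out.
  have [//|q qf|u [us uf]] := outcome_outside_traps tau true f.
    by apply: out; exists q.
  by apply: (win u) => [n nodd|]; [exact: us | rewrite uf].
- move=> [F [ndF ->]].
  have [e eP] := avoiding_strategy (fun n => F n./2) (fun n => ndF _).
  exists e => u follows [k _ Fu].
  apply: (eP u k.*2.+1); last by rewrite /= uphalf_double.
  by apply: follows; rewrite /= odd_double.
Qed.
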